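(* There exists an LCL problem $\Pi$ on the family of all graphs of maximum degree bounded by a constant that is $\Theta(\sqrt{n})$-mendable: $\Pi$ is $T$-mendable for some function $T$ with $T(n)=O(\sqrt{n})$, and $\Pi$ is not $T'$-mendable for any function $T'$ with $T'(n)=o(\sqrt{n})$.
   Context: A locally verifiable problem $\Pi$ on a graph family $\mathcal{G}$ is given by a set $\Sigma$ of input labels, a set $\Gamma$ of output labels and a verifier $\psi$ with verification radius $r\in\mathbb{N}$: for a graph $G=(V,E)\in\mathcal{G}$ with input labeling, an output labeling $\lambda:V\to\Gamma$ and a node $v$, $\psi(G,\lambda,v)\in\{\text{happy},\text{unhappy}\}$ depends only on the radius-$r$ neighborhood of $v$ (structure, inputs and outputs, up to isomorphism). $\lambda$ is a solution if $\psi$ is happy at every node. $\Pi$ is an LCL problem if $\Sigma,\Gamma$ are finite and all graphs in $\mathcal{G}$ have maximum degree bounded by a constant. Partial labelings are maps $\lambda:V\to\Gamma\cup\{\bot\}$; the relaxed verifier $\psi^*$ is happy at $v$ if some node within distance $r$ of $v$ has label $\bot$, and otherwise $\psi^*(G,\lambda,v)=\psi(G,\lambda',v)$ for any $\lambda':V\to\Gamma$ agreeing with $\lambda$ on the radius-$r$ neighborhood of $v$; $\psi^*$ accepts $\lambda$ if it is happy at all nodes. Given $\lambda$ accepted by $\psi^*$ and a node $v$, a $t$-mend of $\lambda$ at $v$ is a partial labeling $\mu$ such that $\psi^*$ accepts $\mu$, $\mu(v)\neq\bot$, $\mu(u)=\bot$ implies $\lambda(u)=\bot$, and $\mu(u)\neq\lambda(u)$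 implies $u$ is within distance $t$ of $v$. A verifier $\psi$ is $T$-mendable if for every $G\in\mathcal{G}$ with $n$ nodes, every partial labeling $\lambda$ accepted by $\psi^*$ and every node $v$, a $T(n)$-mend of $\lambda$ at $v$ exists. $\Pi$ is $T$-mendable if for some $r$ there is a radius-$r$ verifier for $\Pi$ (accepting exactly the solutions of $\Pi$) that is $T$-mendable. *)

(* Defs.v *)
From Stdlib Require Import Reals.
From mathcomp Require Import all_boot.

Set Implicit Arguments.
Unset Strict Implicit.
Unset Printing Implicit Defensive.

Definition graph_in_family (Delta : nat) (V : finType) (e : rel V) : Prop :=
  symmetric e /\ irreflexive e /\ (forall v : V, #|[set u | e v u]| <= Delta).

Definition within (V : finType) (e : rel V) (t : nat) (v u : V) : Prop :=
  exists p : seq V, [&& path e v p, last v p == u & size p <= t].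

Definition verifier (Sigma Gamma : Type) : Type :=
  forall V : finType, rel V -> (V -> Sigma) -> (V -> Gamma) -> V -> bool.

Definition problem (Sigma Gamma : Type) : Type :=
  forall V : finType, rel V -> (V -> Sigma) -> (V -> Gamma) -> Prop.

Definition ball_iso (Sigma Gamma : Type) (r : nat)
    (V : finType) (e : rel V) (inp : V -> Sigma) (lab : V -> Gamma) (v : V)
    (V' : finType) (e' : rel V') (inp' : V' -> Sigma) (lab' : V' -> Gamma) (v' : V')
    : Prop :=
  exists f : V -> V',
    f v = v' /\
    (forall u, within e r v u -> within e' r v' (f u)) /\
    (forall u1 u2, within e r v u1 -> within e r v u2 -> f u1 = f u2 -> u1 = u2) /\
    (forall u', within e' r v' u' -> exists2 u, within e r v u & f u = u') /\
    (forall u1 u2, within e r v u1 -> within e r v u2 -> e' (f u1) (f u2) = e u1 u2) /\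
    (forall u, within e r v u -> inp' (f u) = inp u /\ lab' (f u) = lab u).

Definition has_radius (Sigma Gamma : Type) (Delta r : nat) (psi : verifier Sigma Gamma)
    : Prop :=
  forall (V : finType) (e : rel V) (inp : V -> Sigma) (lab : V -> Gamma) (v : V)
         (V' : finType) (e' : rel V') (inp' : V' -> Sigma) (lab' : V' -> Gamma) (v' : V'),
    graph_in_family Delta e -> graph_in_family Delta e' ->
    ball_iso r e inp lab v e' inp' lab' v' ->
    psi V e inp lab v = psi V' e' inp' lab' v'.

Definition verifies (Sigma Gamma : Type) (Delta : nat) (psi : verifier Sigma Gamma)
    (Pi : problem Sigma Gamma) : Prop :=
  forall (V : finType) (e : rel V), graph_in_family Delta e ->
    forall (inp : V -> Sigma) (lab : V -> Gamma),
      (forall v, psi V e inp lab v) <-> Pi V e inp lab.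

Definition relaxed_accepts (Sigma Gamma : Type) (r : nat) (psi : verifier Sigma Gamma)
    (V : finType) (e : rel V) (inp : V -> Sigma) (mu : V -> option Gamma) : Prop :=
  forall v : V,
    (exists u, within e r v u /\ mu u = None) \/
    (forall lab : V -> Gamma,
        (forall u, within e r v u -> mu u = Some (lab u)) -> psi V e inp lab v).

Definition is_mend (Sigma Gamma : Type) (r : nat) (psi : verifier Sigma Gamma)
    (V : finType) (e : rel V) (inp : V -> Sigma) (lam : V -> option Gamma) (v : V)
    (t : nat) (mu : V -> option Gamma) : Prop :=
  [/\ relaxed_accepts r psi e inp mu,
      mu v <> None,
      (forall u, mu u = None -> lam u = None)
    & (forall u, mu u <> lam u -> within e t v u)].

Definition verifier_mendable (Sigma Gamma : Type) (Delta r : nat)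
    (psi : verifier Sigma Gamma) (T : nat -> nat) : Prop :=
  forall (V : finType) (e : rel V), graph_in_family Delta e ->
    forall (inp : V -> Sigma) (lam : V -> option Gamma),
      relaxed_accepts r psi e inp lam ->
      forall v : V, exists mu, is_mend r psi e inp lam v (T #|V|) mu.

Definition is_LCL (Sigma Gamma : finType) (Delta : nat) (Pi : problem Sigma Gamma) : Prop :=
  exists (r : nat) (psi : verifier Sigma Gamma), has_radius Delta r psi /\ verifies Delta psi Pi.

Definition mendable (Sigma Gamma : Type) (Delta : nat) (Pi : problem Sigma Gamma)
    (T : nat -> nat) : Prop :=
  exists (r : nat) (psi : verifier Sigma Gamma),
    [/\ has_radius Delta r psi, verifies Delta psi Pi & verifier_mendable Delta r psi T].

Definition bigO_sqrt (T : nat -> nat) : Prop :=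
  exists (C : R) (N : nat), forall n : nat, (N <= n)%N ->
    Rle (INR (T n)) (Rmult C (sqrt (INR n))).

Definition littleo_sqrt (T : nat -> nat) : Prop :=
  forall eps : R, Rlt R0 eps -> exists N : nat, forall n : nat, (N <= n)%N ->
    Rle (INR (T n)) (Rmult eps (sqrt (INR n))).

(* Main.v *)
Require Import Defs.
From Stdlib Require Import Reals Lra.
From mathcomp Require Import all_boot zify.

(* Input labels pretend to be plane coordinates modulo 3, and a node is good
   when these labels single out one northern, one eastern and one western
   neighbour.  An output is either empty or a pointer north, east or west; at a
   good node, the node pointed at must be nonempty and must not point straight
   back.  A chain of pointers can only end at a node that is not good, or run into
   itself.

   Upper bound: a node x pointed at must be made the start of a chain.  If the
   ball of radius 2m around x, where (m+1)^2 > n, is empty, labelled and good, two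
   of the (m+1)^2 walks "j steps north, then i <= m steps east" from x end at the
   same node.  As west undoes east, this gives E^a N^j x = N^j' x with a >= 0.
   Hence going j' north and then a west (if j <= j'), or j north and then a east
   (if j > j'), is a legal chain from x that runs into itself.

   Lower bound: in a square grid, a chain arriving at the centre from the south
   must reach the boundary or be erased altogether, since pointers never go south
   and so never close up. *)

Set Implicit Arguments.
Unset Strict Implicit.
Unset Printing Implicit Defensive.

(* [Some true] is east, [Some false] is west. *)
Notation dir := (option bool).
Notation north := (None : dir).

(* The input label expected at the neighbour in direction [d]. *)
Definition shift (d : dir) (s : 'I_3 * 'I_3) : 'I_3 * 'I_3 :=
  match d with
  | None => (s.1, ordS s.2)
  | Some true => (ordS s.1, s.2)
  | Some false => (ord_pred s.1, s.2)
  end.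

(** Only turning back between east and west is excluded; no pointer goes south, so north combines
    with everything. *)
Definition compat (d d' : dir) : bool :=
  match d, d' with Some b, Some b' => b == b' | _, _ => true end.

Definition follows (d : dir) (g : option dir) : bool := oapp (compat d) false g.

Lemma compat_north d : compat d north.
Proof. by case: d. Qed.

Lemma shiftK b : cancel (shift (Some b)) (shift (Some (~~ b))).
Proof. by case: b => -[x y] /=; rewrite ?ordSK ?ord_predK. Qed.

(** * Pointers on graphs with coordinates *)

Section Step.
Variables (V : finType) (e : rel V) (inp : V -> 'I_3 * 'I_3).

Definition step (d : dir) (u w : V) : bool := e u w && (inp w == shift d (inp u)).

Definition good (u : V) : bool := [forall d : dir, #|[pred w | step d u w]| == 1].

(** The default [u] is never taken at a good node. *)
Definition target (d : dir) (u : V) : V := odflt u [pick w | step d u w].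

Lemma step_target d u : good u -> step d u (target d u).
Proof.
move=> /forallP/(_ d)/eqP/mem_card1[w Hw].
rewrite /target; case: pickP => [//|/(_ w)].
by move: (Hw w); rewrite !inE eqxx => ->.
Qed.

Lemma step_uniq d u w w' : good u -> step d u w -> step d u w' -> w = w'.
Proof.
move=> /forallP/(_ d)/eqP/mem_card1[x Hx] Hw Hw'.
move: (Hx w) (Hx w'); rewrite !inE Hw Hw'.
by move=> /esym/eqP-> /esym/eqP->.
Qed.

Lemma target_eq d u w : good u -> step d u w -> target d u = w.
Proof. by move=> gu; apply: step_uniq (step_target d gu). Qed.

Lemma step_back b u w : symmetric e -> step (Some b) u w -> step (Some (~~ b)) w u.
Proof. by move=> syme /andP[euw /eqP Hw]; rewrite /step syme euw Hw shiftK eqxx. Qed.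

Lemma targetK b u : symmetric e -> good u -> good (target (Some b) u) ->
  target (Some (~~ b)) (target (Some b) u) = u.
Proof. by move=> syme gu gw; apply: target_eq => //; apply/step_back/step_target. Qed.

Definition pointers_ok (lab : V -> option dir) (u : V) : bool :=
  good u ==> [forall d : dir, (lab u == Some d) ==>
                [forall w, step d u w ==> follows d (lab w)]].

End Step.

Definition pointer_verifier : verifier ('I_3 * 'I_3)%type (option dir) :=
  fun V e inp lab u => pointers_ok e inp lab u.

Definition pointer_problem : problem ('I_3 * 'I_3)%type (option dir) :=
  fun V e inp lab => forall u, pointers_ok e inp lab u.

(** * Distances in graphs and the verification radius *)

Lemma within1 (V : finType) (e : rel V) (v u : V) :
  within e 1 v u <-> (u == v) || e v u.
Proof.
split=> [[[|a [|b p]] /and3P[pp /eqP<- _]] //|/orP[/eqP->|evu]].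
- by rewrite eqxx.
- by move: pp => /= /andP[->]; rewrite orbT.
- by exists [::]; rewrite /= eqxx.
- by exists [:: u]; rewrite /= evu eqxx.
Qed.

Lemma within0 (V : finType) (e : rel V) t (v : V) : within e t v v.
Proof. by exists [::]; rewrite /= eqxx. Qed.

Lemma within_trans (V : finType) (e : rel V) s t (u v w : V) :
  within e s u v -> within e t v w -> within e (s + t) u w.
Proof.
move=> [p /and3P[pp /eqP lp sp]] [q /and3P[pq lq sq]]; exists (p ++ q).
by rewrite cat_path last_cat size_cat lp pp pq lq leq_add.
Qed.

Lemma within_le (V : finType) (e : rel V) s t (u v : V) :
  s <= t -> within e s u v -> within e t u v.
Proof.
move=> st [p /and3P[pp lp sp]]; exists p.
by rewrite pp lp (leq_trans sp st).
Qed.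

Lemma within_step (V : finType) (e : rel V) t (u v w : V) :
  within e t u v -> e v w -> within e t.+1 u w.
Proof.
move=> Huv evw; rewrite -addn1; apply: within_trans Huv _.
by apply/within1; rewrite evw orbT.
Qed.

(** The isomorphism maps the candidates for each direction bijectively, so goodness and targets
    agree on both sides. *)
Lemma pointer_verifier_radius Delta : has_radius Delta 1 pointer_verifier.
Proof.
move=> V e inp lab v V' e' inp' lab' v' _ _ [f [fv [f1 [finj [fsurj [fe flab]]]]]].
have inB w : e v w -> within e 1 v w by move=> ev; apply/within1; rewrite ev orbT.
have vB : within e 1 v v by apply: within0.
have [inpv labv] := flab _ vB; rewrite fv in inpv labv.
have stepE d w : within e 1 v w -> step e' inp' d v' (f w) = step e inp d v w.
  by move=> wB; rewrite /step inpv (flab _ wB).1 -fv fe.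
have step_pre d w' : step e' inp' d v' w' -> exists2 w, step e inp d v w & f w = w'.
  move=> st; have [|w wB fw] := fsurj w'.
    by apply/within1; case/andP: st => ->; rewrite orbT.
  by exists w => //; rewrite -stepE ?fw.
rewrite /pointer_verifier /pointers_ok; congr (_ ==> _).
  apply: eq_forallb => d.
  have <- : #|image f [pred w | step e inp d v w]| = #|[pred w | step e inp d v w]|.
    apply: card_in_image => x y; rewrite !inE => /andP[ex _] /andP[ey _].
    by apply: finj; apply: inB.
  congr (_ == _); apply: eq_card => w'; apply/imageP/idP.
    by case=> w; rewrite !inE => st ->; rewrite stepE //; apply: inB; case/andP: st.
  by rewrite inE => /step_pre[w st <-]; exists w.
apply: eq_forallb => d; rewrite labv; congr (_ ==> _); apply/forallP/forallP => H w.
  apply/implyP => /step_pre[x st <-].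
  have wB : within e 1 v x by apply: inB; case/andP: st.
  by rewrite (flab _ wB).2; move/implyP: (H x); apply.
apply/implyP => st; have wB : within e 1 v w by apply: inB; case/andP: st.
by have /implyP := H (f w); rewrite stepE // (flab _ wB).2; apply.
Qed.

(** * Mending within distance O(sqrt n) *)

Section Mending.
Variables (V : finType) (e : rel V) (inp : V -> 'I_3 * 'I_3).
Hypotheses (syme : symmetric e) (irre : irreflexive e).

Implicit Types (mu : V -> option (option dir)) (u v w x y : V).

Notation good := (good e inp).
Notation step := (step e inp).
Notation target := (target e inp).

Definition blank mu u : bool := [exists x, ((x == u) || e u x) && (mu x == None)].

Definition conflict mu u : bool :=
  [exists d : dir, (mu u == Some (Some d)) &&
     [exists w, step d u w && ~~ oapp (follows d) true (mu w)]].

Definition bad mu u : bool := [&& good u, ~~ blank mu u & conflict mu u].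

Lemma not_blank mu u x : ~~ blank mu u -> (x == u) || e u x -> mu x <> None.
Proof. by rewrite negb_exists => /forallP/(_ x); rewrite negb_and => /orP[/negP//|/eqP]. Qed.

Lemma relaxed_acceptsP mu :
  relaxed_accepts 1 pointer_verifier e inp mu <-> (forall u, ~~ bad mu u).
Proof.
split=> [H u|H u].
  apply/negP => /and3P[gu nb /existsP[d /andP[/eqP muu /existsP[w /andP[st nf]]]]].
  have [[x [/within1 ux mux]]|lab_ok] := H u; first exact: not_blank nb ux mux.
  (* The default is not taken on the ball, since [u] is not blank. *)
  have agree x : within e 1 u x -> mu x = Some (odflt None (mu x)).
    by move=> /within1 ux; move: (not_blank nb ux); case: (mu x).
  have /implyP/(_ gu)/forallP/(_ d) := lab_ok _ agree.
  rewrite muu eqxx /= => /forallP/(_ w)/implyP/(_ st).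
  by case: (mu w) nf => //= g /negP.
have [/existsP[x /andP[ux /eqP mux]]|nb] := boolP (blank mu u).
  by left; exists x; split=> //; apply/within1.
right=> lab Hlab; apply/implyP => gu; apply/forallP => d; apply/implyP => /eqP labu.
apply/forallP => w; apply/implyP => st; apply/negPn/negP => nf.
have muu : mu u = Some (lab u) by apply/Hlab/within0.
have muw : mu w = Some (lab w) by apply/Hlab/within1; case/andP: st => ->; rewrite orbT.
move/negP: (H u); apply; rewrite /bad gu nb /=; apply/existsP; exists d.
by rewrite muu labu eqxx; apply/existsP; exists w; rewrite st muw.
Qed.

Lemma blank_eq mu mu' : (forall u, (mu u == None) = (mu' u == None)) -> blank mu =1 blank mu'.
Proof. by move=> H u; apply: eq_existsb => x; rewrite H. Qed.

Section Ball.
Variables (v : V) (t : nat).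

(* The nodes concerned are never bad: once they point north, a chain may safely
   end at them. *)
Definition settled mu : Prop := forall u, within e t v u ->
  ~~ good u || blank mu u -> mu u <> None -> mu u = Some (Some north).

(** [B] holds the bad nodes left for later repairs. They keep pointing north, so that [bad_target]
    stays applicable and their own chains can still start there. *)
Definition patch (B : {set V}) mu mu' : Prop :=
  [/\ forall u, (mu u == None) = (mu' u == None),
      forall u, mu' u <> mu u -> within e t v u,
      settled mu',
      forall u, bad mu' u -> u \in B
    & forall u, u \in B -> mu' u = Some (Some north)].

Definition walk x (ds : seq dir) : V := foldl (fun y d => target d y) x ds.

(* A conflict with an opposite pointer would make [target d y] bad as well, and
   bad nodes other than [y] point north. *)
Lemma bad_target (B : {set V}) mu d y :
  (forall u, u \in B -> mu u = Some (Some north)) -> settled mu ->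
  (forall u, bad mu u -> u \in B \/ u = y) -> within e t v (target d y) ->
  mu y = Some (Some d) -> bad mu y -> mu (target d y) = Some None.
Proof.
move=> BN stl badB wx muy /and3P[gy nby /existsP[d' /andP[]]].
rewrite muy => /eqP[<-] /existsP[x /andP[st]].
have xE := target_eq gy st; rewrite xE in wx *.
have eyx : e y x by case/andP: st.
have mux : mu x <> None by apply: (not_blank nby); rewrite eyx orbT.
case mux' : (mu x) mux => [[g|//]|//] _ /=.
case: d muy st xE {d'} => [b|//] muy st xE; case: g mux' => [b'|//] mux' /= nbb'.
have bE : b' = ~~ b by case: (b) (b') nbb' => -[].
exfalso; have stl_x := stl x wx; rewrite mux' in stl_x.
have /andP[gx nbx] : good x && ~~ blank mu x.
  rewrite -[good x]negbK -negb_or; apply/negP => f.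
  by case: (stl_x f).
have bx : bad mu x.
  rewrite /bad gx nbx; apply/existsP; exists (Some b'); rewrite mux' eqxx /=.
  apply/existsP; exists y; rewrite muy /= bE (step_back syme st) /=.
  by case: (b).
have [xB|xy] := badB x bx; first by move: (BN x xB); rewrite mux'.
by move: eyx; rewrite xy irre.
Qed.

(* Extending the chain by one pointer moves the badness from its head [y] to the
   next node and creates no other bad node. *)
Lemma walkP (B : {set V}) (ds : seq dir) : forall mu d y k,
  mu y = Some (Some d) -> (forall u, bad mu u -> u \in B \/ u = y) ->
  (forall u, u \in B -> mu u = Some (Some north)) -> settled mu ->
  path compat d ds -> within e k v y -> k + size ds < t ->
  (exists mu', patch B mu mu') \/
  (forall n, good (walk (target d y) (take n ds)) /\
     mu (walk (target d y) (take n ds)) = Some None) /\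
  (forall n n', n < n' <= size ds ->
     walk (target d y) (take n ds) <> walk (target d y) (take n' ds)).
Proof.
elim: ds => [|d' ds IH] mu d y k muy badB BN stl cds wy kt;
  have [by_|nby] := boolP (bad mu y); try by
  left; exists mu; split=> // u bu; case: (badB u bu) => // uy; rewrite -uy bu in nby.
all: have st : step d y (target d y) by apply: step_target; case/andP: by_.
all: have wx : within e k.+1 v (target d y) by apply: within_step wy _; case/andP: st.
all: have wtx : within e t v (target d y) by apply: within_le wx; move: kt => /=; lia.
all: have mux := bad_target BN stl badB wtx muy by_.
all: have gx : good (target d y) /\ ~~ blank mu (target d y)
  by apply/andP; rewrite -[good _]negbK -negb_or; apply/negP => f;
     move: (stl _ wtx f); rewrite mux; case.
  by right; split=> [n|n n']; [split; case: gx | case: n' => [|n'] /=; rewrite ?ltn0 ?andbF].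
set x := target d y in st wx wtx mux gx *.
pose mu' u := if u == x then Some (Some d') else mu u.
have mu'x : mu' x = Some (Some d') by rewrite /mu' eqxx.
have mu'u u : u != x -> mu' u = mu u by rewrite /mu' => /negPf->.
have noneE u : (mu u == None) = (mu' u == None).
  by rewrite /mu'; case: (u =P x) => // ->; rewrite mux.
have xy : y != x by apply/eqP => yx; move: mux; rewrite -yx muy.
have /= /andP[cdd' cds'] := cds.
have badB' u : bad mu' u -> u \in B \/ u = x.
  move=> bu; have [->|/eqP ux] := u =P x; [by right|left].
  have [gu nbu cu] := and3P bu.
  have [/badB[//|uy]|nb] := boolP (bad mu u).
    exfalso; rewrite uy in bu gu cu; case/existsP: cu => d1 /andP[].
    rewrite mu'u // muy => /eqP[<-] /existsP[w /andP[stw]].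
    by rewrite -(target_eq gu stw) mu'x /= cdd'.
  (* Any other conflict existed under [mu] already: a pointer into [x] was in conflict while [x] was
     empty. *)
  exfalso; move/negP: nb; apply; rewrite /bad gu (blank_eq noneE) nbu /=.
  case/existsP: cu => d1 /andP[mu1 /existsP[w /andP[stw nf]]].
  apply/existsP; exists d1; rewrite -mu'u // mu1; apply/existsP; exists w.
  rewrite stw /=; have [wx'|wx'] := eqVneq w x; first by rewrite wx' mux.
  by rewrite -mu'u.
have BN' u : u \in B -> mu' u = Some (Some north).
  by move=> uB; rewrite mu'u ?BN //; apply/eqP => ux; move: (BN u uB); rewrite ux mux.
have stl' : settled mu'.
  move=> u wu; have [->|ux] := eqVneq u x.
    by rewrite -(blank_eq noneE) gx.1 (negPf gx.2).
  by rewrite -(blank_eq noneE) mu'u //; apply: stl.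
have kt' : k.+1 + size ds < t by move: kt => /=; lia.
have [[mu2 [none2 ch2 stl2 bad2 BN2]]|[walk_none walk_inj]] :=
  IH mu' d' x k.+1 mu'x badB' BN' stl' cds' wx kt'.
  left; exists mu2; split=> // u; first by rewrite noneE.
  have [->//|ux] := eqVneq u x; by rewrite -(mu'u u ux) => /ch2.
right.
(* The rest of the walk is empty under [mu'], whereas [x] now has a pointer; so the walk never
   returns to [x]. *)
have nx n : walk (target d' x) (take n ds) != x.
  by apply/eqP => E; case: (walk_none n); rewrite E mu'x.
split=> [[|n] /=|[|n] [|n'] //= lt]; first by case: gx.
    by rewrite -(mu'u _ (nx n)).
  by apply/eqP; rewrite eq_sym nx.
exact: walk_inj.
Qed.

Lemma walk_nseq x d n : walk x (nseq n d) = iter n (target d) x.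
Proof. by elim: n x => //= n IH x; rewrite [walk _ _]IH -iterSr. Qed.

Lemma walk_cat x ds ds' : walk x (ds ++ ds') = walk (walk x ds) ds'.
Proof. exact: foldl_cat. Qed.

(** Opposite steps cancel by [targetK], one on each side at a time; this is why both rows must be
    good. *)
Lemma iter_cancel b x y i i' :
  (forall s, s <= i -> good (iter s (target (Some b)) x)) ->
  (forall s, s <= i' -> good (iter s (target (Some b)) y)) -> i' <= i ->
  iter i (target (Some b)) x = iter i' (target (Some b)) y ->
  iter (i - i') (target (Some b)) x = y.
Proof.
elim: i' i => [|i' IH] i gi gi' le; first by rewrite subn0.
case: i gi le => // i gi le E; rewrite subSS; apply: IH => //.
- by move=> s les; apply: gi; lia.
- by move=> s les; apply: gi'; lia.
have := congr1 (target (Some (~~ b))) E; rewrite !iterS !targetK //.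
- exact: (gi' i').
- exact: (gi' i'.+1).
- exact: (gi i).
- exact: (gi i.+1).
Qed.

Lemma iter_targetK b x n : (forall s, s <= n -> good (iter s (target (Some b)) x)) ->
  iter n (target (Some (~~ b))) (iter n (target (Some b)) x) = x.
Proof.
elim: n => // n IH gn; rewrite iterSr iterS targetK //; first last.
- exact: (gn n.+1).
- exact: gn.
by apply: IH => s les; apply: gn; lia.
Qed.

Lemma path_compat_north d n ds : path compat d (nseq n north ++ ds) =
  if n is 0 then path compat d ds else path compat north ds.
Proof.
elim: n d => // n IH d; rewrite /= compat_north IH.
by case: n {IH}.
Qed.

Lemma path_compat_nseq b n : path compat north (nseq n (Some b)).
Proof. by case: n => //= n; elim: n => //= n ->; rewrite eqxx. Qed.

Lemma path_compat_steps n b i : path compat north (nseq n north ++ nseq i (Some b)).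
Proof. by rewrite path_compat_north path_compat_nseq; case: n. Qed.

Lemma fix_one (B : {set V}) mu y k m :
  mu y = Some (Some north) -> (forall u, bad mu u -> u \in B \/ u = y) ->
  (forall u, u \in B -> mu u = Some (Some north)) -> settled mu ->
  within e k v y -> k + m.*2 < t -> #|V| < m.+1 ^ 2 ->
  exists mu', patch B mu mu'.
Proof.
move=> muy badB BN stl wy kt cardV.
set x := target north y.
pose P (p : 'I_m.+1 * 'I_m.+1) : V := iter p.2 (target (Some true)) (iter p.1 (target north) x).
have : ~~ injectiveb P.
  apply/negP => /injectiveP/leq_card; rewrite card_prod card_ord leqNgt mulnn.
  by rewrite cardV.
case/injectivePn => p [q pq Ppq].
wlog le_qp : p q pq Ppq / q.2 <= p.2.
  move=> H; case: (leqP q.2 p.2) => [|/ltnW] le; first exact: (H p q).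
  by apply: (H q p) => //; rewrite eq_sym.
(* By [walkP], a legal walk either yields the patch, or its horizontal run is good and its last node
   differs from all earlier ones. *)
have walk_steps (b : bool) (j i : nat) : j <= m -> i <= m ->
  (exists mu', patch B mu mu') \/
  (forall s, s <= i -> good (iter s (target (Some b)) (iter j (target north) x))) /\
  (forall n, n < j + i ->
     walk x (take n (nseq j north ++ nseq i (Some b))) <>
     iter i (target (Some b)) (iter j (target north) x)).
  move=> jm im; set ds := nseq j north ++ nseq i (Some b).
  have size_ds : size ds = j + i by rewrite size_cat !size_nseq.
  have kds : k + size ds < t by rewrite size_ds; lia.
  have [|[gds inj]] := walkP muy badB BN stl (path_compat_steps j b i) wy kds; first by left.
  right; split=> [s si|n nji].
    have [+ _] := gds (j + s); rewrite take_cat size_nseq ltnNge leq_addr /= addKn.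
    by rewrite take_nseq // walk_cat !walk_nseq.
  have := inj n (j + i); rewrite size_ds nji leqnn => /(_ isT).
  by rewrite -size_ds take_size walk_cat !walk_nseq.
have [pm qm] : p.1 <= m /\ p.2 <= m by split; rewrite -ltnS ltn_ord.
have [q1m q2m] : q.1 <= m /\ q.2 <= m by split; rewrite -ltnS ltn_ord.
have [//|[gp _]] := walk_steps true p.1 p.2 pm qm.
have [//|[gq _]] := walk_steps true q.1 q.2 q1m q2m.
have Epq := iter_cancel gp gq le_qp Ppq.
have le_diff : p.2 - q.2 <= m by lia.
(* [Epq] leads from height [p.1] of the northern line to height [q.1] by [p.2 - q.2] steps east. If
   [p.1 <= q.1], going [q.1] north and then west closes up at height [p.1]. *)
have [le1|lt1] := leqP p.1 q.1.
  have [//|[_ inj]] := walk_steps false q.1 (p.2 - q.2) q1m le_diff.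
  case: (inj p.1).
    (* Height [p.1] is strictly before the end of the walk, unless [p = q]. *)
    have [E1|] := eqVneq (p.1 : nat) q.1; last lia.
    have [E2|] := eqVneq (p.2 : nat) q.2; last lia.
    case/eqP: pq; case: p q E1 E2 {Ppq le_qp pm qm q1m q2m gp gq Epq le_diff le1 inj}.
    by move=> p1 p2 [q1 q2] /= /val_inj-> /val_inj->.
  rewrite -Epq (@iter_targetK true) => [|s les]; last by apply: gp; lia.
  rewrite take_cat size_nseq; case: ltnP => lt1; first by rewrite take_nseq ?walk_nseq.
  have -> : p.1 = q.1 :> nat by lia.
  by rewrite subnn take0 cats0 walk_nseq.
(* Going [p.1] north and then east closes up at height [q.1 < p.1]. *)
have [//|[_ inj]] := walk_steps true p.1 (p.2 - q.2) pm le_diff.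
case: (inj q.1); first by lia.
by rewrite Epq take_cat size_nseq lt1 take_nseq ?walk_nseq // ltnW.
Qed.

Lemma patch_trans mu1 mu2 mu3 (B B' : {set V}) : patch B mu1 mu2 -> patch B' mu2 mu3 ->
  patch B' mu1 mu3.
Proof.
move=> [n12 c12 _ _ _] [n23 c23 s3 b3 B3]; split=> // u; first by rewrite n12.
move=> ne; have [E|/eqP ne12] := mu2 u =P mu1 u; last by apply/c12/eqP.
by apply: c23; rewrite E.
Qed.

(** Induction on the number of bad nodes: the others form the [B] of [fix_one], so each repair
    leaves at most those, still pointing north. *)
Lemma fix_all mu k m :
  (forall u, bad mu u -> mu u = Some (Some north) /\ within e k v u) -> settled mu ->
  k + m.*2 < t -> #|V| < m.+1 ^ 2 -> exists mu', patch set0 mu mu'.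
Proof.
move=> badN stl kt cardV; have [c] := ubnP #|[set u | bad mu u]|.
elim: c mu badN stl => // c IH mu badN stl; rewrite ltnS => lec.
have [E|[y]] := set_0Vmem [set u | bad mu u].
  exists mu; split=> // u; last by rewrite inE.
  by move=> bu; rewrite -E inE.
rewrite inE => by_; have [muy wy] := badN y by_.
pose B := [set u | bad mu u] :\ y.
have badB u : bad mu u -> u \in B \/ u = y.
  by move=> bu; have [->|/eqP uy] := u =P y; [right|left; rewrite !inE uy].
have BN u : u \in B -> mu u = Some (Some north).
  by rewrite !inE => /andP[_ /badN[]].
have [mu1 P1] := fix_one muy badB BN stl wy kt cardV.
have [_ _ stl1 bad1 BN1] := P1.
have [u bu||mu2 P2] := IH mu1 _ stl1.
- split; first exact/BN1/bad1.
  by have := bad1 u bu; rewrite !inE => /andP[_ /badN[]].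
- apply: leq_trans lec; apply: proper_card; apply/properP; split.
    by apply/subsetP => u; rewrite !inE => /bad1; rewrite !inE => /andP[].
  by exists y; rewrite !inE //; apply/negP => /bad1; rewrite !inE eqxx.
by exists mu2; apply: patch_trans P1 P2.
Qed.
End Ball.
End Mending.

(** * The mend of a partial labelling and its radius *)

Definition in_ball (V : finType) (e : rel V) (t : nat) (v u : V) : bool :=
  [exists k : 'I_t.+1, [exists p : k.-tuple V, path e v p && (last v p == u)]].

Lemma withinP (V : finType) (e : rel V) (t : nat) (v u : V) :
  reflect (within e t v u) (in_ball e t v u).
Proof.
apply: (iffP existsP) => [[k /existsP[p /andP[pp lp]]]|[p /and3P[pp lp sp]]].
  by exists p; rewrite pp lp size_tuple -ltnS ltn_ord.
by exists (Ordinal (sp : size p < t.+1)); apply/existsP; exists (in_tuple p); rewrite pp lp.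
Qed.

(** Two runs of at most the integer square root each; of the 2, one is the distance from [v] to a
    bad node and one makes the bound in [fix_all] strict. *)
Definition mend_radius (n : nat) : nat := (PeanoNat.Nat.sqrt n).*2 + 2.

(** Filling the hole with north affects blankness only in the closed neighbourhood of [v]. Labelled
    nodes there, and those of the ball that cannot be bad, are turned north, which harms no pointer
    into them. All bad nodes then lie next to or at [v] and point north, as [fix_all] requires. *)
Lemma pointer_verifier_mendable Delta :
  verifier_mendable Delta 1 pointer_verifier mend_radius.
Proof.
move=> V e [syme [irre _]] inp lam acc v.
have [lamv|/eqP lamv] := eqVneq (lam v) None; last by exists lam; split=> // u [].
set t := mend_radius #|V|.
pose lam1 u := if u == v then Some (Some north) else lam u.
pose reset u := (lam1 u != None) &&
  (((u == v) || e v u) ||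
   in_ball e t v u && (~~ good e inp u || blank e lam1 u)).
pose mu u := if reset u then Some (Some north) else lam1 u.
have noneE u : (lam1 u == None) = (mu u == None).
  by rewrite /mu /reset; have [->//|/negPf E] := eqVneq (lam1 u) None; case: ifP.
have mu_near u : (u == v) || e v u -> mu u <> None -> mu u = Some (Some north).
  by move=> uv /eqP; rewrite -noneE /mu /reset uv => ->.
have stl : settled e inp v t mu.
  move=> u /withinP wu; rewrite -(blank_eq _ noneE) => fu /eqP.
  by rewrite -noneE /mu /reset wu fu orbT => ->.
have badN u : bad e inp mu u -> mu u = Some (Some north) /\ within e 1 v u.
  move=> bu; have [gu nbu cu] := and3P bu.
  have [uv|nuv] := boolP ((u == v) || e v u).
    split; last exact/within1.
    by apply: (mu_near _ uv); apply: (not_blank nbu); rewrite eqxx.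
  (* Away from [v], a bad node was not reset, so it would already be bad for [lam]. *)
  have luE : mu u = lam u.
    rewrite /mu /reset (negPf nuv) gu (blank_eq e noneE) (negPf nbu) andbF andbF /lam1.
    by case: eqP nuv => // ->; rewrite eqxx.
  have lamE x : lam x = None -> x != v -> mu x = None.
    by move=> lx xv; apply/eqP; rewrite -noneE /lam1 (negPf xv) lx.
  have /negP[] := (relaxed_acceptsP e inp lam).1 acc u.
  rewrite /bad gu /=; apply/andP; split.
    apply: contra nbu => /existsP[x /andP[ux /eqP lx]].
    apply/existsP; exists x; rewrite ux lamE //.
    by apply: contra nuv => /eqP<-; rewrite eq_sym syme.
  case/existsP: cu => d /andP[mud /existsP[w /andP[st nf]]].
  apply/existsP; exists d; rewrite -luE mud; apply/existsP; exists w; rewrite st.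
  have wv : w != v.
    by apply: contra nuv => /eqP<-; rewrite syme; case/andP: st => ->; rewrite orbT.
  move: nf; rewrite /mu; case: ifP => _ /=; first by rewrite /follows /= compat_north.
  by rewrite /lam1 (negPf wv).
have kt : 1 + (PeanoNat.Nat.sqrt #|V|).*2 < t by rewrite /t /mend_radius; lia.
have cardV : #|V| < (PeanoNat.Nat.sqrt #|V|).+1 ^ 2.
  have := PeanoNat.Nat.sqrt_spec #|V| (PeanoNat.Nat.le_0_l _).
  by rewrite -mulnn; lia.
have [mu' [none' ch' _ bad' _]] := fix_all syme irre badN stl kt cardV.
exists mu'; split.
- by apply/(relaxed_acceptsP e inp) => u; apply/negP => /bad'; rewrite inE.
- by apply/eqP; rewrite -none' -noneE /lam1 eqxx.
- move=> u /eqP; rewrite -none' -noneE /lam1; by case: (u =P v) => // _ /eqP.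
move=> u ne; have [E|/eqP ne'] := mu' u =P mu u; last by apply/ch'/eqP.
have wu : within e 1 v u -> within e t v u by apply: within_le; rewrite /t /mend_radius addn2.
move: ne; rewrite E /mu; case: ifP => [/andP[_ /orP[uv|/andP[/withinP//]]] _|_].
  exact/wu/within1.
by rewrite /lam1; case: (u =P v) => // -> _; apply: within0.
Qed.

Lemma mend_radius_sqrt : bigO_sqrt mend_radius.
Proof.
(* With [s] at most the root of [n], and that root at least 1, [2s + 2] is at most 4 times the
   root. *)
exists (IZR 4), 1 => n n1; rewrite /mend_radius.
set s := PeanoNat.Nat.sqrt n.
have [sn _] := PeanoNat.Nat.sqrt_spec n (PeanoNat.Nat.le_0_l _).
have le_s : Rle (INR s) (sqrt (INR n)).
  rewrite -(sqrt_square (INR s)); last exact: pos_INR.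
  by apply: sqrt_le_1_alt; rewrite -mult_INR; apply: le_INR.
have le_1 : Rle (IZR 1) (sqrt (INR n)).
  by rewrite -sqrt_1; apply: sqrt_le_1_alt; apply: (le_INR 1); apply/leP.
have -> : s.*2 + 2 = Nat.add (Nat.mul 2 s) 2 by lia.
by rewrite plus_INR mult_INR /=; lra.
Qed.

(** * The square grid needs distance Omega(sqrt n) *)

Section Grid.
Variable c : nat.
Let m := c.*2.+1.
Notation cell := ('I_m * 'I_m)%type.
Implicit Types (u w : cell) (d : dir).

Definition grid : rel cell := fun u w =>
  ((u.1 == w.1) && ((u.2.+1 == w.2 :> nat) || (w.2.+1 == u.2 :> nat)))
  || ((u.2 == w.2) && ((u.1.+1 == w.1 :> nat) || (w.1.+1 == u.1 :> nat))).

Definition mod3 (n : nat) : 'I_3 := Ordinal (ltn_pmod n (isT : 0 < 3)).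

Definition coords u : 'I_3 * 'I_3 := (mod3 u.1, mod3 u.2).

Lemma gridE u w : grid u w =
  ((u.1 == w.1 :> nat) && ((u.2.+1 == w.2 :> nat) || (w.2.+1 == u.2 :> nat)))
  || ((u.2 == w.2 :> nat) && ((u.1.+1 == w.1 :> nat) || (w.1.+1 == u.1 :> nat))).
Proof. by []. Qed.

Lemma cell_eq u w : u.1 = w.1 :> nat -> u.2 = w.2 :> nat -> u = w.
Proof. by case: u w => [a b] [a' b'] /= /val_inj-> /val_inj->. Qed.

Lemma coords_inj u w w' : grid u w -> grid u w' -> coords w = coords w' -> w = w'.
Proof.
rewrite !gridE => uw uw' [/eqP E1 /eqP E2]; apply: cell_eq; move: uw uw' E1 E2; lia.
Qed.

(** The neighbours of a node carry distinct labels by [coords_inj], and there are 9 labels. *)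
Lemma grid_in_family : graph_in_family 9 grid.
Proof.
split; [|split].
- by move=> u w; rewrite !gridE; apply/idP/idP; lia.
- by move=> u; rewrite gridE; lia.
move=> u; have <- : #|[set coords w | w in [set w | grid u w]]| = #|[set w | grid u w]|.
  by apply: card_in_imset => w w'; rewrite !inE; apply: coords_inj.
by apply: leq_trans (max_card _) _; rewrite card_prod card_ord.
Qed.

(* The west entry at [x = 0] is junk, but is not adjacent to [(x, y)]. *)
Definition next d (x y : nat) : nat * nat :=
  match d with
  | None => (x, y.+1)
  | Some true => (x.+1, y)
  | Some false => (x.-1, y)
  end.

(** Residues modulo 3 tell a forward step from a backward one, so between neighbours the labels
    reveal the true direction. *)
Lemma step_gridP d u w : step grid coords d u w -> (w.1 : nat, w.2 : nat) = next d u.1 u.2.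
Proof.
rewrite /step gridE => /andP[uw /eqP sh].
have [E1 E2] : (coords w).1 = (shift d (coords u)).1 :> nat /\
  (coords w).2 = (shift d (coords u)).2 :> nat by rewrite sh.
case: d E1 E2 {sh} => [[]|] /= E1 E2; congr pair; move: uw E1 E2; lia.
Qed.

(** The southern side is included, as goodness asks for no southern neighbour; a chain can thus
    start at the very bottom. *)
Lemma grid_good u : 0 < u.1 -> u.1.+1 < m -> u.2.+1 < m -> good grid coords u.
Proof.
move=> u10 u1m u2m; apply/forallP => d.
have [n1 n2] : (next d u.1 u.2).1 < m /\ (next d u.1 u.2).2 < m.
  by case: d => [[]|] /=; split; lia.
pose w : cell := (Ordinal n1, Ordinal n2).
rewrite (@eq_card1 _ w) // => w'; rewrite !inE; apply/idP/eqP => [/step_gridP E|->].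
  by apply: cell_eq; rewrite /= -E.
apply/andP; split; first by rewrite gridE /=; case: d {n1 n2 w} => [[]|] /=; lia.
by case: d n1 n2 @w => [[]|] n1 n2 /=; rewrite -pair_eqE /= -!val_eqE /=; lia.
Qed.

(** Manhattan distance: under truncated subtraction, the two opposite differences add up to an
    absolute value. *)
Definition dist u w : nat := (u.1 - w.1) + (w.1 - u.1) + ((u.2 - w.2) + (w.2 - u.2)).

Lemma dist_step u w x : grid u w -> dist u x <= (dist w x).+1.
Proof. by rewrite gridE /dist; lia. Qed.

Lemma within_grid t u w : reflect (within grid t u w) (dist u w <= t).
Proof.
apply: (iffP idP) => [|[p /and3P[pp /eqP<- sp]]]; last first.
  apply: leq_trans sp; elim: p u pp => [|x p IH] u /=; first by rewrite /dist; lia.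
  by move=> /andP[/dist_step ux /IH le]; apply: leq_trans (ux _) _.
elim: t u => [|t IH] u dt.
  suff -> : u = w by apply: within0.
  by apply: cell_eq; move: dt; rewrite /dist; lia.
have [E|ne] := eqVneq u w; first by rewrite E; apply: within0.
suff [x ux xt] : exists2 x, grid u x & dist x w <= t.
  have [p /and3P[pp lp sp]] := IH x xt.
  by exists (x :: p); rewrite /= ux pp lp ltnS sp.
have [ltw1 ltw2 ltu1 ltu2] : [/\ w.1 < m, w.2 < m, u.1 < m & u.2 < m] by split.
have ne12 : (u.1 != w.1 :> nat) || (u.2 != w.2 :> nat).
  by apply: contraNT ne; rewrite negb_or !negbK => /andP[/eqP ? /eqP ?]; apply/eqP/cell_eq.
case: (ltngtP u.1 w.1) ne12 => [lt|lt|E1] /=.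
- have b : u.1.+1 < m by lia.
  by exists (Ordinal b, u.2); [rewrite gridE /=|move: dt; rewrite /dist /=]; lia.
- have b : u.1.-1 < m by lia.
  by exists (Ordinal b, u.2); [rewrite gridE /=|move: dt; rewrite /dist /=]; lia.
case: (ltngtP u.2 w.2) => // lt _.
- have b : u.2.+1 < m by lia.
  by exists (u.1, Ordinal b); [rewrite gridE /=|move: dt; rewrite /dist /=]; lia.
have b : u.2.-1 < m by lia.
by exists (u.1, Ordinal b); [rewrite gridE /=|move: dt; rewrite /dist /=]; lia.
Qed.

Lemma center_bound : c < m. Proof. by rewrite /m; lia. Qed.

Definition center : cell := (Ordinal center_bound, Ordinal center_bound).

Definition column (h : nat) u : option dir :=
  if (u.1 == c :> nat) && (u.2 < h) then Some north else None.

Definition column_hole u : option (option dir) :=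
  if u == center then None else Some (column c u).

Lemma column_solution h : h = 0 \/ h = m -> pointer_problem grid coords (column h).
Proof.
move=> hE u; apply/implyP => _; apply/forallP => d; apply/implyP => /eqP.
rewrite /column; case: ifP => // /andP[/eqP u1 u2] [<-].
apply/forallP => w; apply/implyP => /step_gridP[w1 w2].
by rewrite w1 u1 eqxx; case: hE u2 => -> // _; rewrite ltn_ord.
Qed.

(* A ball that misses the hole sees the column only below the hole or only
   above it. *)
Lemma hole_shadow r u w : dist u w <= r -> r < dist u center -> w.1 = c :> nat ->
  (w.2 < c) = (w.2 < if u.2 <= c then m else 0).
Proof.
rewrite /dist /= => near far w1; have w2 := ltn_ord w.2.
by case: ifP => u2; apply/idP/idP; lia.
Qed.

(** Whatever the verifier and its radius, a ball missing the hole looks like the same ball in the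
    solution [column m] or [column 0], so locality transfers the verdict. *)
Lemma column_hole_accepted r (psi : verifier ('I_3 * 'I_3)%type (option dir)) :
  has_radius 9 r psi -> verifies 9 psi pointer_problem ->
  relaxed_accepts r psi grid coords column_hole.
Proof.
move=> rad ver u; have [near|far] := leqP (dist u center) r.
  by left; exists center; split; [apply/within_grid|rewrite /column_hole eqxx].
right=> lab Hlab; pose h := if u.2 <= c then m else 0.
have sol : pointer_problem grid coords (column h).
  by apply: column_solution; rewrite /h; case: ifP; [right|left].
rewrite (rad _ _ _ _ _ _ grid coords (column h) u grid_in_family grid_in_family).
  exact: ((ver _ _ grid_in_family _ _).2 sol).
exists id; split; [by []|split; [by []|split; [by []|split]]].
  by move=> w ww; exists w.
split=> // w ww; split=> //; apply/esym.
have := Hlab w ww; rewrite /column_hole; case: eqP => // _ [<-].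
move: ww => /within_grid/hole_shadow/(_ far) E.
by rewrite /column; case: (w.1 =P c :> nat) => //= /E->.
Qed.

Lemma no_far_completion (lab : cell -> option dir) : 0 < c ->
  pointer_problem grid coords lab ->
  (forall u, c <= dist center u -> lab u = column c u) -> False.
Proof.
move=> c0 sol far; have mE : m = c.*2.+1 by [].
(* Far pointers lie in the column below the centre, and nodes nearer than [c] avoid the boundary; so
   pointers occur only at good nodes. *)
have inner u : lab u != None -> [/\ 0 < u.1, u.1.+1 < m & u.2.+1 < m].
  move=> lu; have [|near] := leqP c (dist center u).
    move=> /far E; move: lu; rewrite E /column; case: ifP => // /andP[/eqP-> u2] _.
    by split; lia.
  by move: near; rewrite /dist /= => near; split; lia.
have succ u d : lab u = Some d ->
    exists w, (w.1 : nat, w.2 : nat) = next d u.1 u.2 /\ follows d (lab w).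
  move=> lu; have [|u1 u2 u3] := inner u; first by rewrite lu.
  have gu := grid_good u1 u2 u3; exists (target grid coords d u).
  split; first exact/step_gridP/step_target.
  have /implyP/(_ gu)/forallP/(_ d) := sol u; rewrite lu eqxx => /forallP/(_ _)/implyP.
  by apply; apply: step_target.
have m0 : 0 < m by [].
(* The bottom of the column is at distance exactly [c] from the centre, so its pointer is
   prescribed. *)
pose start : cell := (Ordinal center_bound, Ordinal m0).
have startP : lab start != None.
  by rewrite far /column /dist /= ?eqxx ?c0 //; lia.
(* Among the topmost pointers, all horizontal, take the easternmost one pointing
   east or the westernmost one pointing west: its target is beyond it. *)
have [top lt top_max] := @arg_maxnP _ start (fun u => lab u != None) (fun u => u.2 : nat) startP.
have horizontal u : lab u != None -> u.2 = top.2 :> nat -> lab u <> Some north.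
  move=> lu u2 /succ[w [[_ w2] fw]]; suff : w.2 <= top.2 by lia.
  by apply: top_max; case: (lab w) fw.
pose run b u := (lab u == Some (Some b)) && (u.2 == top.2 :> nat).
have run_succ b u : run b u -> exists2 w, run b w &
    (w.1 : nat) = if b then u.1.+1 else u.1.-1.
  move=> /andP[/eqP lu /eqP u2]; have [w [E fw]] := succ u _ lu; exists w; last first.
    by case: b E {lu fw} => -[].
  have w2 : w.2 = top.2 :> nat by case: b E {lu fw} => -[_ ->].
  rewrite /run w2 eqxx andbT; case lw : (lab w) fw => [[b'|]|] //=.
    by move=> /eqP->.
  by case: (@horizontal w) => //; rewrite lw.
case ltop : (lab top) lt => [[b|]|] // _; last by case: (@horizontal top); rewrite ?ltop.
have runb : run b top by rewrite /run ltop !eqxx.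
case: b {ltop} runb => runb.
  have [u ru u_max] := @arg_maxnP _ top (run true) (fun u => u.1 : nat) runb.
  by have [w /u_max + E] := run_succ _ _ ru; rewrite E; lia.
have [u ru u_min] := @arg_minnP _ top (run false) (fun u => u.1 : nat) runb.
have [w /u_min + E] := run_succ _ _ ru; rewrite E.
(* [inner] gives [0 < u.1], so [u.1.-1] is strictly smaller. *)
have [|] := inner u; first by case/andP: ru => /eqP->.
by move=> /= ; lia.
Qed.

End Grid.

Lemma pointer_problem_hard (T : nat -> nat) :
  littleo_sqrt T -> ~ mendable 9 pointer_problem T.
Proof.
move=> oT [r [psi [rad ver mend]]].
(* As [m = 2c + 1 <= 3c], the factor 1/8 gives [T (m * m) <= m / 8 < c]; [c = N + 1] makes the grid
   large enough. *)
have [|N HN] := oT (Rinv (IZR 8)); first by lra.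
pose c := N.+1; pose m := c.*2.+1.
have card_grid : #|{: 'I_m * 'I_m}| = m * m by rewrite card_prod card_ord.
have Tc : T (m * m) < c.
  have Nm : N <= m * m by apply: (@leq_trans m); [rewrite /m /c; lia|exact: leq_pmulr].
  have := HN _ Nm; rewrite mult_INR sqrt_square; last exact: pos_INR.
  move=> le; apply/ltP/INR_lt; apply: Rle_lt_trans le _.
  have -> : m = Nat.add (Nat.mul 2 c) 1 by rewrite /m; lia.
  have c1 : Rle (IZR 1) (INR c) by apply: (le_INR 1); apply/leP.
  by rewrite plus_INR mult_INR; move: (INR c) c1 => x c1 /=; lra.
have [mu [acc mu0 none ch]] :=
  mend _ _ (grid_in_family c) _ _ (column_hole_accepted rad ver) (center c).
(* Only the centre was unlabelled and the mend labels it, so [mu] is total and hence a true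
   solution. *)
have total u : mu u <> None.
  move=> mu_none; have := none u mu_none; rewrite /column_hole.
  by case: eqP => // uc; case: mu0; rewrite -uc.
pose lab u := odflt None (mu u).
have muE u : mu u = Some (lab u) by rewrite /lab; move: (total u); case: (mu u).
have sol : pointer_problem (@grid c) (@coords c) lab.
  apply/(ver _ _ (grid_in_family c)) => u.
  by have [[w [_ /total]]|] := acc u; last apply.
apply: (no_far_completion (isT : 0 < c) sol) => u far.
have [E|ne] := mu u =P column_hole u.
  move: E; rewrite muE /column_hole; case: eqP => // _ [//].
by move: (ch u ne) => /within_grid; rewrite card_grid; lia.
Qed.

Theorem theorem8p7 :
  exists (Delta : nat) (Sigma Gamma : finType) (Pi : problem Sigma Gamma),
    [/\ is_LCL Delta Pi,
        (exists T : nat -> nat, bigO_sqrt T /\ mendable Delta Pi T)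
      & (forall T' : nat -> nat, littleo_sqrt T' -> ~ mendable Delta Pi T')].
Proof.
exists 9, ('I_3 * 'I_3)%type, (option dir), pointer_problem; split.
- by exists 1, pointer_verifier; split; first exact: pointer_verifier_radius.
- exists mend_radius; split; first exact: mend_radius_sqrt.
  exists 1, pointer_verifier; split; first exact: pointer_verifier_radius.
    by [].
  exact: pointer_verifier_mendable.
exact: pointer_problem_hard.
Qed.
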